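(* Let $d>0$, $\lambda>0$, let $A\in\mathbb{R}^{m\times n}$ with $m<n$, let $\widetilde{x}\in\{0,\pm d\}^n$ be a $k$-sparse signal, and let $y=A\widetilde{x}$. Let $$\mathcal{F}(x)=\frac12\|y-Ax\|_2^2+\lambda d\|x\|_1-\frac{\lambda}{2}\|x\|_2^2,\qquad x\in[-d,d]^n.$$ If $A$ satisfies the $\ell_2$-robust null space property (RNSP) of order $k$ with parameters $\tau>0$ and $\rho\in\left(0,\sqrt{1-\lambda\tau^2}\right)$ (provided that $\lambda<\tau^{-2}$), then $\widetilde{x}$ is the unique global minimum point of $\mathcal{F}$ over $[-d,d]^n$.
   Context: A vector is $k$-sparse if its support $S$ (set of indices of non-zero components) satisfies $|S|=k$. For $v\in\mathbb{R}^n$ and $S\subseteq\{1,\dots,n\}$, $v_S$ is the restriction of $v$ to the components in $S$, and $S^c$ is the complement of $S$. RNSP: a matrix $A\in\mathbb{R}^{m\times n}$ satisfies the $\ell_2$-robust null space property of order $k$ with parameters $\rho\in(0,1)$, $\tau>0$ if $$\|v_S\|_2\le \frac{\rho}{\sqrt{k}}\|v_{S^c}\|_1+\tau\|Av\|_2$$ for any $v\in\mathbb{R}^n$ and any $S\subset\{1,\dots,n\}$ with $|S|\le k$. *)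

(* Defs.v *)
From mathcomp Require Import all_boot all_order all_algebra.
From mathcomp Require Import classical_sets reals.

Set Implicit Arguments.
Unset Strict Implicit.
Unset Printing Implicit Defensive.

Import Order.TTheory GRing.Theory Num.Theory.
Local Open Scope ring_scope.

(* The canonical norm on matrices in MathComp-Analysis is the sup norm, hence
   the explicit l1 and l2 norms. *)
Definition l1norm (R : realType) (n : nat) (v : 'cV[R]_n) : R :=
  \sum_(i < n) `|v i 0|.

Definition l2norm (R : realType) (n : nat) (v : 'cV[R]_n) : R :=
  Num.sqrt (\sum_(i < n) v i 0 ^+ 2).

Definition supp (R : realType) (n : nat) (v : 'cV[R]_n) : {set 'I_n} :=
  [set i | v i 0 != 0].

Definition sparse (R : realType) (n k : nat) (v : 'cV[R]_n) : Prop :=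
  #|supp v| = k.

(* The restriction v_S is extended by zero outside S, which changes neither of
   its norms. *)
Definition restr (R : realType) (n : nat) (S : {set 'I_n}) (v : 'cV[R]_n) :
    'cV[R]_n :=
  \col_i (if i \in S then v i 0 else 0).

(* For [k = 0] the factor [rho / Num.sqrt 0] is 0 by convention, and the
   inequality (only required for the empty set) always holds. *)
Definition RNSP (R : realType) (m n : nat) (A : 'M[R]_(m, n)) (k : nat)
    (rho tau : R) : Prop :=
  [/\ 0 < rho < 1, 0 < tau &
      forall (v : 'cV[R]_n) (S : {set 'I_n}), (#|S| <= k)%N ->
        l2norm (restr S v) <=
          rho / Num.sqrt k%:R * l1norm (restr (~: S) v)
          + tau * l2norm (A *m v)].

Definition objective (R : realType) (m n : nat) (A : 'M[R]_(m, n))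
    (y : 'cV[R]_m) (d lambda : R) (x : 'cV[R]_n) : R :=
  1 / 2 * l2norm (y - A *m x) ^+ 2 + lambda * d * l1norm x
  - lambda / 2 * l2norm x ^+ 2.

Definition box (R : realType) (n : nat) (d : R) : set 'cV[R]_n :=
  [set x | forall i, - d <= x i 0 <= d]%classic.

Definition global_min_point (R : realType) (T : Type) (D : set T) (f : T -> R)
    (x : T) : Prop :=
  D x /\ forall z : T, D z -> f x <= f z.

Definition unique_global_min_point (R : realType) (T : Type) (D : set T)
    (f : T -> R) (x : T) : Prop :=
  global_min_point D f x /\
  forall z : T, global_min_point D f z -> z = x.

(* Main.v *)
Require Import Defs.
From mathcomp Require Import all_boot all_order all_algebra.
From mathcomp Require Import classical_sets reals.
From mathcomp Require Import ring lra.


(** Write [g t = d * `|t| - t ^+ 2 / 2] for the penalty of one coordinate, [S]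
    for the support of [xt] and [v = z - xt] for the displacement to a point
    [z <> xt] of the box.  The identity
    [g t = d ^+ 2 / 2 - (d - `|t|) ^+ 2 / 2] says that the coordinates in [S],
    where [xt] has modulus [d], maximise the penalty: moving them can only
    lower it, by [(d - `|z_i|) ^+ 2 / 2].  Each coordinate outside [S] raises
    it by at least [d * `|v_i| / 2], since [`|v_i| <= d].  With
    [a] the l2 norm of [A *m v], [b] the l1 norm of [v] outside [S] and [c] the
    sum of [(d - `|z_i|) ^+ 2] over [S], twice the gap of the objective between
    [z] and [xt] is thus at least [a ^+ 2 + lambda * (d * b - c)]
    ([objective_gap]), and this quantity is positive ([gap_bound_gt0]):
    - if [b > k * d], the trivial bound [c <= k * d ^+ 2] suffices;
    - if [b <= k * d], then [b ^+ 2 / k <= d * b]; moreover [c] is at most the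
      squared l2 norm of [v] on [S], and the null space property followed by
      Cauchy-Schwarz bounds [lambda * c] by
      [(rho ^+ 2 + lambda * tau ^+ 2) * (a ^+ 2 + lambda * (b ^+ 2 / k))],
      where the first factor is below 1 exactly by the assumption on [rho].
      If the second factor vanishes, so do [a], [c] and [v] on [S]; then
      [v <> 0] forces [b > 0]. *)

Set Implicit Arguments.
Unset Strict Implicit.
Unset Printing Implicit Defensive.

Import Order.TTheory GRing.Theory Num.Theory.
Local Open Scope ring_scope.

Lemma l2norm_ge0 (R : realType) (n : nat) (v : 'cV[R]_n) : 0 <= l2norm v.
Proof. exact: sqrtr_ge0. Qed.

Lemma l1norm_ge0 (R : realType) (n : nat) (v : 'cV[R]_n) : 0 <= l1norm v.
Proof. by apply: sumr_ge0 => i _. Qed.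

Lemma l2norm_sqr (R : realType) (n : nat) (v : 'cV[R]_n) :
  l2norm v ^+ 2 = \sum_(i < n) v i 0 ^+ 2.
Proof. by rewrite sqr_sqrtr // sumr_ge0 // => i _; apply: sqr_ge0. Qed.

Lemma l2norm_eq0 (R : realType) (n : nat) (v : 'cV[R]_n) :
  l2norm v = 0 -> v = 0.
Proof.
move=> v0; have := l2norm_sqr v; rewrite v0 expr0n /= => /esym/eqP.
rewrite psumr_eq0 => [/allP v0i|i _]; last exact: sqr_ge0.
apply/matrixP => i j; rewrite ord1 mxE; apply/eqP.
by rewrite -sqrf_eq0; apply: v0i; rewrite mem_index_enum.
Qed.

Lemma l1norm_eq0 (R : realType) (n : nat) (v : 'cV[R]_n) :
  l1norm v = 0 -> v = 0.
Proof.
move/eqP; rewrite psumr_eq0 // => /allP v0i.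
apply/matrixP => i j; rewrite ord1 mxE; apply/eqP.
by rewrite -normr_eq0; apply: v0i; rewrite mem_index_enum.
Qed.

Lemma restr_setC (R : realType) (n : nat) (S : {set 'I_n}) (v : 'cV[R]_n) :
  restr S v + restr (~: S) v = v.
Proof.
apply/matrixP => i j; rewrite ord1 !mxE finset.in_setC.
by case: (i \in S); rewrite ?addr0 ?add0r.
Qed.

Lemma l1norm_restr (R : realType) (n : nat) (S : {set 'I_n}) (v : 'cV[R]_n) :
  l1norm (restr S v) = \sum_(i in S) `|v i 0|.
Proof.
rewrite [RHS]big_mkcond; apply: eq_bigr => i _; rewrite mxE.
by case: ifP; rewrite ?normr0.
Qed.

Lemma l2norm_sqr_restr (R : realType) (n : nat) (S : {set 'I_n})
    (v : 'cV[R]_n) :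
  l2norm (restr S v) ^+ 2 = \sum_(i in S) v i 0 ^+ 2.
Proof.
rewrite l2norm_sqr [RHS]big_mkcond; apply: eq_bigr => i _; rewrite mxE.
by case: ifP; rewrite ?expr0n.
Qed.

(** The Cauchy-Schwarz inequality for [(r, sqrt lambda * tau)] and
    [(sqrt lambda * beta, a)], which weights the two terms of the null space
    inequality so that they match the two terms of the objective. *)
Lemma weighted_cauchy_schwarz (R : realFieldType)
    (lambda tau r a beta : R) :
  lambda * (r * beta + tau * a) ^+ 2 <=
    (r ^+ 2 + lambda * tau ^+ 2) * (a ^+ 2 + lambda * beta ^+ 2).
Proof.
rewrite -subr_ge0.
have -> : (r ^+ 2 + lambda * tau ^+ 2) * (a ^+ 2 + lambda * beta ^+ 2)
    - lambda * (r * beta + tau * a) ^+ 2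
    = (r * a - lambda * tau * beta) ^+ 2 by ring.
exact: sqr_ge0.
Qed.

(** Here [s] stands for the l2 norm of the displacement on the support and
    [beta] for [b / sqrt K].  Asking only for [beta ^+ 2 <= d * b] covers
    [K = 0] as well, where that quotient is zero. *)
Lemma gap_bound_gt0 (R : realFieldType)
    (lambda tau r d K a b c s beta : R) :
  0 < lambda -> 0 < d -> r ^+ 2 + lambda * tau ^+ 2 < 1 ->
  0 <= b -> 0 <= s -> (0 < b) || (0 < s) ->
  c <= s ^+ 2 -> c <= K * d ^+ 2 ->
  s <= r * beta + tau * a ->
  (b <= K * d -> beta ^+ 2 <= d * b) ->
  0 < a ^+ 2 + lambda * (d * b - c).
Proof.
move=> l0 d0 rho1 b0 s0 bs cs cK sab betab.
case: (ltP (K * d) b) => [bK|/betab {}betab].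
  apply: ltr_wpDl; first exact: sqr_ge0.
  apply: mulr_gt0 => //; rewrite subr_gt0; apply: le_lt_trans cK _.
  by rewrite expr2 mulrA mulrC ltr_pM2l.
have lc : lambda * c <= lambda * s ^+ 2 by rewrite ler_pM2l.
have lbeta : lambda * beta ^+ 2 <= lambda * (d * b) by rewrite ler_pM2l.
have ls : lambda * s ^+ 2 <= lambda * (r * beta + tau * a) ^+ 2.
  by rewrite ler_pM2l // ler_pXn2r // nnegrE // (le_trans s0).
have CS := weighted_cauchy_schwarz lambda tau r a beta.
have a20 := sqr_ge0 a.
have lb20 : 0 <= lambda * beta ^+ 2 by rewrite mulr_ge0 ?sqr_ge0 // ltW.
set q := a ^+ 2 + lambda * beta ^+ 2 in CS.
have [q0|q0] := ltP 0 q.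
  have : (r ^+ 2 + lambda * tau ^+ 2) * q < 1 * q by rewrite ltr_pM2r.
  by rewrite mulrBr /q in CS *; lra.
(* If [a] and [beta] vanish then so does [s], hence [b > 0] and the term
   [d * b] alone makes the bound positive. *)
have aE : a = 0.
  by apply/eqP; rewrite -sqrf_eq0; apply/eqP; rewrite /q in q0; lra.
have lb2E : lambda * beta ^+ 2 = 0 by rewrite /q in q0; lra.
have betaE : beta = 0.
  by apply/eqP; move/eqP: lb2E; rewrite mulf_eq0 sqrf_eq0 gt_eqF.
have sE : s = 0.
  apply/eqP; rewrite eq_le s0 andbT.
  by rewrite aE betaE !mulr0 addr0 in sab.
move: bs cs; rewrite sE ltxx orbF expr0n /= => b_gt0 c0.
apply: ltr_wpDl => //; apply: mulr_gt0 => //.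
have := mulr_gt0 d0 b_gt0; lra.
Qed.

(** The penalty of one coordinate is largest where the modulus is [d], with an
    exactly quadratic loss away from it. *)
Lemma penalty_completed_square (R : realFieldType) (d t : R) :
  d * `|t| - t ^+ 2 / 2 = d ^+ 2 / 2 - (d - `|t|) ^+ 2 / 2.
Proof. by rewrite -[t ^+ 2]real_normK ?num_real //; field. Qed.

Lemma penalty_off_support (R : realFieldType) (d t : R) :
  `|t| <= d -> d * `|t| / 2 <= d * `|t| - t ^+ 2 / 2.
Proof.
move=> td; rewrite -[t ^+ 2]real_normK ?num_real //.
have : `|t| * `|t| <= d * `|t| by rewrite ler_wpM2r.
by rewrite expr2; lra.
Qed.

Section Gap.

Variables (R : realType) (m n : nat) (d lambda : R) (A : 'M[R]_(m, n)).
Variables (xt z : 'cV[R]_n).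
Hypothesis d_gt0 : 0 < d.
Hypothesis xt_alphabet :
  forall i : 'I_n, [\/ xt i 0 = 0, xt i 0 = d | xt i 0 = - d].
Hypothesis z_box : box d z.

Let S := supp xt.
Let defect := \sum_(i in S) (d - `|z i 0|) ^+ 2.

Lemma normr_box i : `|z i 0| <= d.
Proof. by rewrite ler_norml; apply: z_box. Qed.

Lemma normr_supp i : i \in S -> `|xt i 0| = d.
Proof.
rewrite inE; case: (xt_alphabet i) => ->; rewrite ?eqxx //.
  by rewrite gtr0_norm.
by rewrite normrN gtr0_norm.
Qed.

(** On the support [xt] has modulus [d], so the reverse triangle inequality
    bounds [d - `|z_i|] by the displacement. *)
Lemma defect_le_l2norm : defect <= l2norm (restr S (z - xt)) ^+ 2.
Proof.
rewrite l2norm_sqr_restr; apply: ler_sum => i iS; rewrite !mxE.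
rewrite -[leRHS]real_normK ?num_real // ler_pXn2r //
  ?nnegrE ?subr_ge0 ?normr_box //.
by rewrite -{1}(normr_supp iS) distrC lerB_dist.
Qed.

Lemma defect_le_card : defect <= #|S|%:R * d ^+ 2.
Proof.
rewrite mulr_natl -sumr_const; apply: ler_sum => i _.
have zd := normr_box i.
by rewrite ler_pXn2r // ?nnegrE ?subr_ge0 ?gerBl // ltW.
Qed.

(** The residual vanishes at [xt], so the data term of the gap is exact; the
    estimate is made coordinate by coordinate on the penalty. *)
Lemma objective_gap :
  0 < lambda ->
  l2norm (A *m (z - xt)) ^+ 2
    + lambda * (d * l1norm (restr (~: S) (z - xt)) - defect) <=
  2 * (objective A (A *m xt) d lambda z - objective A (A *m xt) d lambda xt).
Proof.
move=> l0; set pen := fun t : R => d * `|t| - t ^+ 2 / 2.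
have penE (x : 'cV[R]_n) : objective A (A *m xt) d lambda x =
    1 / 2 * l2norm (A *m xt - A *m x) ^+ 2 + lambda * \sum_i pen (x i 0).
  have -> : \sum_i pen (x i 0) = d * l1norm x - l2norm x ^+ 2 / 2.
    by rewrite l2norm_sqr /l1norm mulr_sumr mulr_suml -sumrB.
  by rewrite /objective; field.
have norm0 : l2norm (A *m xt - A *m xt) ^+ 2 = 0.
  by rewrite l2norm_sqr subrr big1 // => i _; rewrite mxE expr0n.
have normN : l2norm (A *m xt - A *m z) ^+ 2 = l2norm (A *m (z - xt)) ^+ 2.
  by rewrite mulmxBr !l2norm_sqr; apply: eq_bigr => i _; rewrite !mxE; ring.
have pen_gap : d * l1norm (restr (~: S) (z - xt)) - defect <=
    2 * (\sum_i pen (z i 0) - \sum_i pen (xt i 0)).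
  have -> : l1norm (restr (~: S) (z - xt)) =
      \sum_(i | i \notin S) `|(z - xt) i 0|.
    by rewrite l1norm_restr; apply: eq_bigl => i; rewrite finset.in_setC.
  rewrite -sumrB [X in _ <= 2 * X](bigID (mem S)) /=.
  rewrite mulrDr !mulr_sumr addrC /defect -sumrN.
  apply: lerD; apply: ler_sum => i iS.
    rewrite /pen !penalty_completed_square normr_supp //; lra.
  have xt0 : xt i 0 = 0 by apply/eqP; rewrite inE negbK in iS.
  have := penalty_off_support (normr_box i).
  by rewrite /pen !mxE xt0 normr0 subr0 expr0n /=; lra.
rewrite !penE norm0 normN.
have : lambda * (d * l1norm (restr (~: S) (z - xt)) - defect) <=
    lambda * (2 * (\sum_i pen (z i 0) - \sum_i pen (xt i 0))).
  by rewrite ler_pM2l.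
lra.
Qed.

End Gap.

(** The case [k = 0] relies on the convention [b / 0 = 0]. *)
Lemma sqr_div_sqrt_le (R : rcfType) (k : nat) (b d : R) :
  0 < d -> 0 <= b -> b <= k%:R * d -> (b / Num.sqrt k%:R) ^+ 2 <= d * b.
Proof.
move=> d0 b0 bk; rewrite expr_div_n sqr_sqrtr ?ler0n //.
case: k bk => [|k] bk; first by rewrite invr0 mulr0 mulr_ge0 // ltW.
by rewrite ler_pdivrMr ?ltr0n // expr2 mulrAC ler_wpM2r // mulrC.
Qed.

Lemma objective_lt (R : realType) (m n k : nat) (d lambda rho tau : R)
    (A : 'M[R]_(m, n)) (xt z : 'cV[R]_n) :
  0 < d -> 0 < lambda -> rho ^+ 2 + lambda * tau ^+ 2 < 1 ->
  (forall i : 'I_n, [\/ xt i 0 = 0, xt i 0 = d | xt i 0 = - d]) ->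
  sparse k xt -> RNSP A k rho tau -> box d z -> z <> xt ->
  objective A (A *m xt) d lambda xt < objective A (A *m xt) d lambda z.
Proof.
move=> d0 l0 rho1 alpha sp [_ _ nsp] zbox zxt.
rewrite -subr_gt0 -(pmulr_rgt0 _ (ltr0Sn R 1)).
apply: lt_le_trans (objective_gap A d0 alpha zbox l0).
set v := z - xt; set S := supp xt.
apply: (gap_bound_gt0 (K := k%:R) (s := l2norm (restr S v)) l0 d0 rho1
  (beta := l1norm (restr (~: S) v) / Num.sqrt k%:R)).
- exact: l1norm_ge0.
- exact: l2norm_ge0.
- rewrite !lt0r l1norm_ge0 l2norm_ge0 !andbT -negb_and.
  apply/negP => /andP[/eqP /l1norm_eq0 v1 /eqP /l2norm_eq0 v2].
  by apply/zxt/subr0_eq; rewrite -/v -(restr_setC S v) v1 v2 addr0.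
- exact: defect_le_l2norm.
- by rewrite -sp; apply: defect_le_card.
- have := nsp v S; rewrite sp => /(_ (leqnn k)).
  by rewrite mulrA [in X in _ -> X](mulrAC rho).
- by apply: sqr_div_sqrt_le => //; apply: l1norm_ge0.
Qed.

Theorem theorem1 (R : realType) (m n k : nat) (d lambda rho tau : R)
    (A : 'M[R]_(m, n)) (xt : 'cV[R]_n) (y : 'cV[R]_m)
    (d_gt0 : 0 < d) (lambda_gt0 : 0 < lambda)
    (lt_mn : (m < n)%N)
    (xt_alphabet : forall i : 'I_n, [\/ xt i 0 = 0, xt i 0 = d | xt i 0 = - d])
    (xt_sparse : sparse k xt)
    (y_def : y = A *m xt)
    (tau_gt0 : 0 < tau)
    (lambda_lt : lambda < tau ^- 2)
    (rho_bounds : 0 < rho < Num.sqrt (1 - lambda * tau ^+ 2))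
    (A_RNSP : RNSP A k rho tau) :
  unique_global_min_point (box d) (objective A y d lambda) xt.
Proof.
have lt1 : 0 < 1 - lambda * tau ^+ 2.
  by rewrite subr_gt0 -ltr_pdivlMr ?exprn_gt0 // mul1r.
have rho1 : rho ^+ 2 + lambda * tau ^+ 2 < 1.
  case/andP: rho_bounds => r0 r1; rewrite -ltrBrDr -(sqr_sqrtr (ltW lt1)).
  by rewrite ltr_pXn2r // nnegrE ?sqrtr_ge0 // ltW.
have xt_box : box d xt.
  move=> i; rewrite -ler_norml.
  by case: (xt_alphabet i) => ->; rewrite ?normr0 ?normrN ?gtr0_norm // ltW.
have lt_obj z : box d z -> z <> xt ->
    objective A y d lambda xt < objective A y d lambda z.
  by rewrite y_def; apply: objective_lt A_RNSP.
split.
  split=> // z zbox; have [->//|/eqP zxt] := eqVneq z xt.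
  exact/ltW/lt_obj.
move=> z [zbox zmin]; have [//|/eqP zxt] := eqVneq z xt.
by have := lt_le_trans (lt_obj _ zbox zxt) (zmin _ xt_box); rewrite ltxx.
Qed.
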